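(* For every positive integer $q$, $2q+3\le\operatorname{achr}(K_6\square K_q)\le 2q+6$.
   Context: For a finite simple graph $G$, $\operatorname{achr}(G)$ (the achromatic number) is the maximum number of colours in a proper vertex colouring of $G$ that is complete, i.e. every pair of distinct colours appears on the two ends of some edge. $K_6\square K_q$ is the Cartesian product of the complete graphs $K_6$ and $K_q$ (vertex set $[1,6]\times[1,q]$, two vertices adjacent iff they agree in exactly one coordinate). *)

(* Defs.v *)
From mathcomp Require Import all_boot.
Set Implicit Arguments.
Unset Strict Implicit.
Unset Printing Implicit Defensive.

Record sgraph := SGraph {
  svertex :> finType;
  sedge : rel svertex;
  sedge_sym : symmetric sedge;
  sedge_irrefl : irreflexive sedge
}.

Section CompleteGraph.
Variable n : nat.

Definition complete_rel : rel 'I_n := [rel x y | x != y].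

Lemma complete_rel_sym : symmetric complete_rel.
Proof. by move=> x y; rewrite /complete_rel /= eq_sym. Qed.

Lemma complete_rel_irrefl : irreflexive complete_rel.
Proof. by move=> x; rewrite /complete_rel /= eqxx. Qed.

Definition complete_graph : sgraph :=
  SGraph complete_rel_sym complete_rel_irrefl.
End CompleteGraph.

Section CartesianProduct.
Variables G H : sgraph.

Definition cartesian_rel : rel (G * H)%type :=
  [rel u v | (u.1 == v.1) && sedge u.2 v.2 || sedge u.1 v.1 && (u.2 == v.2)].

Lemma cartesian_rel_sym : symmetric cartesian_rel.
Proof.
move=> u v; rewrite /cartesian_rel /=.
by rewrite (eq_sym u.1) (eq_sym u.2) (sedge_sym u.1) (sedge_sym u.2).
Qed.

Lemma cartesian_rel_irrefl : irreflexive cartesian_rel.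
Proof. by move=> u; rewrite /cartesian_rel /= !sedge_irrefl andbF. Qed.

Definition cartesian_product : sgraph :=
  SGraph cartesian_rel_sym cartesian_rel_irrefl.
End CartesianProduct.

Lemma cartesian_complete_adj (m n : nat)
  (u v : cartesian_product (complete_graph m) (complete_graph n)) :
  sedge u v = (u.1 == v.1) (+) (u.2 == v.2).
Proof.
rewrite /= /cartesian_rel /= /complete_rel /=.
by case: (u.1 == v.1); case: (u.2 == v.2). Qed.

Section Achromatic.
Variable G : sgraph.

Definition proper_coloring (k : nat) (c : {ffun G -> 'I_k}) : bool :=
  [forall x, forall y, sedge x y ==> (c x != c y)].

Definition uses_all_colors (k : nat) (c : {ffun G -> 'I_k}) : bool :=
  [forall i, exists x, c x == i].

Definition complete_coloring (k : nat) (c : {ffun G -> 'I_k}) : bool :=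
  [forall i, forall j, (i != j) ==>
     [exists x, exists y, [&& sedge x y, c x == i & c y == j]]].

Definition has_complete_coloring (k : nat) : bool :=
  [exists c : {ffun G -> 'I_k},
     [&& proper_coloring c, uses_all_colors c & complete_coloring c]].

(* The bound k <= #|G| loses nothing: see has_complete_coloring_leq. *)
Definition achr : nat := \max_(k < #|G|.+1 | has_complete_coloring k) k.

Lemma has_complete_coloring_leq k : has_complete_coloring k -> k <= #|G|.
Proof.
case/existsP=> c /and3P[_ /forallP onto _].
have -> : k = #|codom c|.
  rewrite -[LHS]card_ord; apply: eq_card => i; symmetry.
  by have /existsP[x /eqP <-] := onto i; rewrite codom_f.
exact: leq_image_card.
Qed.

Lemma leq_achr k : has_complete_coloring k -> k <= achr.
Proof.
move=> ck; have ltk : k < #|G|.+1 by rewrite ltnS has_complete_coloring_leq.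
exact: (@leq_bigmax_cond _ _ (fun i : 'I_#|G|.+1 => i : nat) (Ordinal ltk)).
Qed.

Lemma achr_attained k : has_complete_coloring k -> has_complete_coloring achr.
Proof.
move=> ck; have ltk : k < #|G|.+1 by rewrite ltnS has_complete_coloring_leq.
have ne : 0 < #|[pred i : 'I_#|G|.+1 | has_complete_coloring i]|.
  by apply/card_gt0P; exists (Ordinal ltk).
by have [i ci e] := eq_bigmax_cond (fun i : 'I_#|G|.+1 => i : nat) ne; rewrite /achr e.
Qed.
End Achromatic.

(* Main.v *)
Require Import Defs.
From mathcomp Require Import all_boot zify.

Set Implicit Arguments.
Unset Strict Implicit.
Unset Printing Implicit Defensive.

(** Upper bound: suppose there are at least [2q + 7] colours. A colour used once
    sees only [q + 4] vertices, so every colour is used at least twice, and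
    counting the [6q] vertices gives at least 21 colours used exactly twice.
    Two of them occupy the same pair of rows, as there are only 15 such pairs.
    The first one sees at most [2q + 6] vertices, two of which carry the second
    colour, so it misses some colour.

    Lower bound: write the rows as three pairs 01, 23, 45. The four triples 024,
    035, 125, 134 pairwise share a row and each meets each of the three pairs.
    Hence [m] colours on each triple fill [2m] columns with all adjacencies among
    them realised by rows, whatever the order inside the rows, and they see every
    colour of a core whose row set meets the four triples. Such a core exists
    with 3 columns and 9 colours and with 4 columns and 11 colours. The values
    [q = 1, 2, 5, 6] that this does not reach have explicit colourings. *)

Notation rook m n :=
  (cartesian_product (complete_graph m) (complete_graph n)).

(** * Colours seen from a colour class *)

Section Neighbourhoods.
Variable G : sgraph.
Implicit Types x : G.

Definition nbhd x : {set G} := [set y | sedge x y].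

Variables (k : nat) (c : {ffun G -> 'I_k}).

Definition color_class (a : 'I_k) : {set G} := [set x | c x == a].

Lemma sum_card_color_class : \sum_a #|color_class a| = #|G|.
Proof.
rewrite -sum1_card (partition_big c predT) //=; apply: eq_bigr => a _.
by rewrite -sum1_card; apply: eq_bigl => x; rewrite inE.
Qed.

(** Every colour other than [a] must appear next to a vertex coloured [a], hence inside [N]; the
    successor accounts for [a] itself. *)
Lemma complete_coloring_leq_nbhd (a : 'I_k) (N : {set G}) :
    complete_coloring c -> {in color_class a, forall x, nbhd x \subset N} ->
  k <= #|c @: N|.+1.
Proof.
move=> /forallP cc subN.
suff: [set~ a] \subset c @: N.
  by move/subset_leq_card; rewrite cardsC1 card_ord; lia.
apply/subsetP => b; rewrite !inE => ba.
have /forallP/(_ b)/implyP := cc a; rewrite eq_sym => /(_ ba).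
case/existsP => x /existsP[y /and3P[xy /eqP xa /eqP <-]].
by apply: imset_f; apply: (subsetP (subN x _)); rewrite inE // xa.
Qed.

Lemma imset_card_ltn (N : {set G}) x y :
  x \in N -> y \in N -> x != y -> c x = c y -> #|c @: N| < #|N|.
Proof.
move=> xN yN xy cxy; rewrite ltn_neqAle leq_imset_card andbT.
by apply: contra xy => /imset_injP inj; rewrite (inj x y).
Qed.

End Neighbourhoods.

(** * Upper bound: neighbourhoods and small colour classes in rook graphs *)

Section UpperBound.
Variables m n : nat.
Implicit Types x y : rook m n.

Lemma card_nbhd_rook x : #|nbhd x| <= m.-1 + n.-1.
Proof.
have sub : nbhd x \subset
    setX [set x.1] [set~ x.2] :|: setX [set~ x.1] [set x.2].
  apply/subsetP => y; rewrite inE cartesian_complete_adj !inE.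
  by rewrite (eq_sym y.1) (eq_sym y.2); do 2!case: (_ == _).
apply: leq_trans (subset_leq_card sub) _.
rewrite cardsU !cardsX !cards1 !cardsC1 !card_ord; lia.
Qed.

(** The two other corners of the rectangle spanned by [x] and [y] are common neighbours, so they are
    counted twice. *)
Lemma card_nbhdU_rook x y : x.1 != y.1 -> x.2 != y.2 ->
  #|nbhd x :|: nbhd y| + 2 <= 2 * (m.-1 + n.-1).
Proof.
move=> xy1 xy2; rewrite cardsU.
have := card_nbhd_rook x; have := card_nbhd_rook y.
suff : 2 <= #|nbhd x :&: nbhd y|.
  by have := subset_leq_card (subsetIl (nbhd x) (nbhd y)); lia.
have -> : 2 = #|[set ((x.1, y.2) : rook m n); ((y.1, x.2) : rook m n)]|.
  by rewrite cards2 xpair_eqE (negbTE xy1).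
apply: subset_leq_card; apply/subsetP => z; rewrite !inE.
case/orP => /eqP ->; rewrite !cartesian_complete_adj /= !eqxx.
  by rewrite (negbTE xy2) eq_sym (negbTE xy1).
by rewrite (negbTE xy1) eq_sym (negbTE xy2).
Qed.

Variables (k : nat) (c : {ffun rook m n -> 'I_k}).
Hypothesis compl_c : complete_coloring c.

Lemma color_class1_leq a :
  #|color_class c a| = 1 -> k <= m.-1 + n.-1 + 1.
Proof.
case/eqP/cards1P => x ax.
have := @complete_coloring_leq_nbhd _ _ _ a (nbhd x) compl_c.
rewrite ax => /(_ _)/leq_trans -> //; first by move=> y; rewrite inE => /eqP ->.
by have := card_nbhd_rook x; have := leq_imset_card c (nbhd x); lia.
Qed.

Hypothesis prop_c : proper_coloring c.

Definition color_rows (a : 'I_k) : {set 'I_m} :=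
  [set x.1 | x in color_class c a].

Lemma same_color_neq x y : x != y -> c x = c y -> x.1 != y.1 /\ x.2 != y.2.
Proof.
move=> xy cxy; have /forallP/(_ x)/forallP/(_ y) := prop_c.
rewrite cxy eqxx implybF cartesian_complete_adj.
move: xy; rewrite -pair_eqE /pair_eq /=.
by do 2!case: (_ == _).
Qed.

Lemma card_color_rows a : #|color_rows a| = #|color_class c a|.
Proof.
apply: card_in_imset => x y; rewrite !inE => /eqP xa /eqP ya xy1.
apply/eqP/negPn/negP => /same_color_neq.
by rewrite xa ya xy1 eqxx => /(_ erefl)[].
Qed.

(** Each vertex coloured [a] has a vertex coloured [b] in its row. So [b] occurs twice in the joint
    neighbourhood [N] of the class of [a], and [N] shows at most [#|N| - 1] colours. *)
Lemma same_color_rows_leq a b :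
    #|color_class c a| = 2 -> color_rows a = color_rows b -> a != b ->
  k + 2 <= 2 * (m.-1 + n.-1).
Proof.
move=> a2 rab ab; have /eqP/cards2P[x [y [xy ea]]] := a2.
have /eqP xa : c x == a by move/setP: ea => /(_ x); rewrite !inE eqxx.
have /eqP ya : c y == a.
  by move/setP: ea => /(_ y); rewrite !inE eqxx orbT.
have [xy1 xy2] := same_color_neq xy (etrans xa (esym ya)).
have twin z : c z = a -> exists2 z', c z' = b & z'.1 = z.1.
  move=> za; have : z.1 \in color_rows b.
    by rewrite -rab imset_f // inE za.
  by case/imsetP => z'; rewrite inE => /eqP; exists z'.
have adj_twin z z' : c z = a -> c z' = b -> z'.1 = z.1 -> sedge z z'.
  move=> za zb zz1; rewrite cartesian_complete_adj zz1 eqxx /=.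
  apply: contra ab => /eqP zz2; rewrite -za -zb.
  by rewrite (surjective_pairing z) (surjective_pairing z') zz1 zz2.
have [x' xb xx1] := twin x xa; have [y' yb yy1] := twin y ya.
pose N := nbhd x :|: nbhd y.
have x'N : x' \in N by rewrite !inE (adj_twin x x').
have y'N : y' \in N by rewrite !inE (adj_twin y y') ?orbT.
have xy' : x' != y' by apply: contra xy1 => /eqP xy'; rewrite -xx1 xy' yy1.
have := imset_card_ltn x'N y'N xy' (etrans xb (esym yb)).
have := card_nbhdU_rook xy1 xy2; rewrite -/N.
have : k <= #|c @: N|.+1.
  apply: (complete_coloring_leq_nbhd compl_c (a := a)) => z; rewrite ea !inE.
  by case/orP => /eqP ->; [exact: subsetUl | exact: subsetUr].
lia.
Qed.

End UpperBound.

Lemma complete_coloring_K6_leq q k : 0 < q ->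
  has_complete_coloring (rook 6 q) k -> k <= 2 * q + 6.
Proof.
move=> q_gt0 /existsP[c /and3P[prop_c onto_c compl_c]].
rewrite leqNgt; apply/negP => k_gt.
have gt1 a : 1 < #|color_class c a|.
  have := @color_class1_leq _ _ _ _ compl_c a.
  have /forallP/(_ a)/existsP[x xa] := onto_c.
  have : 0 < #|color_class c a| by apply/card_gt0P; exists x; rewrite inE.
  by case: #|_| => [|[|//]] // _ /(_ erefl); lia.
pose D := [set a | #|color_class c a| == 2].
have D_le : #|D| <= 15.
  have <- : #|color_rows c @: D| = #|D|.
    apply: card_in_imset => a b; rewrite !inE => /eqP a2 /eqP b2 rab.
    apply/eqP/negPn/negP => ab.
    by have := same_color_rows_leq compl_c prop_c a2 rab ab; lia.
  have -> : 15 = #|[set A : {set 'I_6} | #|A| == 2]|.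
    by rewrite card_draws card_ord.
  apply: subset_leq_card; apply/subsetP => A /imsetP[a aD ->].
  by rewrite !inE in aD *; rewrite card_color_rows.
(* Topping up the classes of size 2 to size 3 gives [3 * k <= 6 * q + 15], against
   [k >= 2 * q + 7]. *)
have : \sum_(a : 'I_k) 3 <= \sum_a (#|color_class c a| + (a \in D)).
  apply: leq_sum => a _; have := gt1 a; rewrite inE.
  by case: #|_| => [|[|[|]]] //=; lia.
have sumC := sum_card_color_class c; rewrite card_prod !card_ord in sumC.
have sumD : \sum_(a : 'I_k) (a \in D) = #|D|.
  by rewrite -sum1_card [RHS]big_mkcond; apply: eq_bigr => a _; case: (a \in D).
rewrite big_split sumC sumD sum_nat_const card_ord => le3.
by have := leq_trans le3 (leq_add (leqnn (6 * q)) D_le); lia.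
Qed.

(** * Lower bound: colourings as arrays with six rows *)

(** Arbitrary index types let columns and colours be disjoint sums later on. The case [a = b] of the
    last clause makes every colour occur. *)
Definition complete_array (J K : Type) (f : 'I_6 -> J -> K) : Prop :=
  [/\ forall r, injective (f r),
      forall j, injective (f^~ j)
    & forall a b, (exists r i j, f r i = a /\ f r j = b) \/
                  (exists j r s, f r j = a /\ f s j = b)].

Lemma complete_array_coloring (J K : finType) (f : 'I_6 -> J -> K) :
  complete_array f -> has_complete_coloring (rook 6 #|J|) #|K|.
Proof.
case=> row_inj col_inj compl_f.
pose c : {ffun rook 6 #|J| -> 'I_#|K|} :=
  [ffun x => enum_rank (f x.1 (enum_val x.2))].
have cE r j : c (r, enum_rank j) = enum_rank (f r j).
  by rewrite ffunE /= enum_rankK.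
apply/existsP; exists c; apply/and3P; split.
- apply/forallP => -[r i]; apply/forallP => -[s j].
  rewrite cartesian_complete_adj /= !ffunE /=; apply/implyP.
  apply: contraL => /eqP/enum_rank_inj; case: (r =P s) => [<-|rs].
    by move/row_inj/enum_val_inj ->; rewrite eqxx.
  case: (i =P j) => // <- /(col_inj (enum_val i) r s) //.
- apply/forallP => a; apply/existsP.
  have [[r [i [_ [fa _]]]]|[i [r [_ [fa _]]]]] :=
    compl_f (enum_val a) (enum_val a);
  by exists (r, enum_rank i); rewrite cE fa enum_valK.
apply/forallP => a; apply/forallP => b; apply/implyP => ab.
apply/existsP.
have [[r [i [j [fa fb]]]]|[j [r [s [fa fb]]]]] :=
  compl_f (enum_val a) (enum_val b).
  exists (r, enum_rank i); apply/existsP; exists (r, enum_rank j).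
  rewrite cartesian_complete_adj !cE fa fb !enum_valK !eqxx !andbT /=.
  apply: contra ab => /eqP/enum_rank_inj ij.
  by rewrite -(inj_eq enum_val_inj) -fa -fb ij.
exists (r, enum_rank j); apply/existsP; exists (s, enum_rank j).
rewrite cartesian_complete_adj !cE fa fb !enum_valK !eqxx !andbT addbT.
apply: contra ab => /eqP /= rs.
by rewrite -(inj_eq enum_val_inj) -fa -fb rs.
Qed.

(** * Concrete arrays checked by computation *)

Section Tables.
Variables s k : nat.
Implicit Type t : seq (seq nat).

Definition table_lines t :=
  t ++ [seq [seq nth 0 l j | l <- t] | j <- iota 0 s].

(** A decidable form of [complete_array]; there are [k.+1] colours so that [inord] applies. *)
Definition complete_table t :=
  [&& size t == 6, all (fun l => size l == s) t,
      all uniq (table_lines t), all (all (fun a => a < k.+1)) t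
    & all2rel (fun a b => has (fun l => (a \in l) && (b \in l)) (table_lines t))
        (iota 0 k.+1)].

Definition table_array t (r : 'I_6) (j : 'I_s) : 'I_k.+1 :=
  inord (nth 0 (nth [::] t r) j).

Variable t : seq (seq nat).
Hypothesis compl_t : complete_table t.

Lemma size_table : size t = 6.
Proof. by case/and5P: compl_t => /eqP. Qed.

Lemma row_table_in (r : 'I_6) : nth [::] t r \in t.
Proof. by rewrite mem_nth // size_table. Qed.

Lemma size_row_table (r : 'I_6) : size (nth [::] t r) = s.
Proof.
by case/and5P: compl_t => _ /allP/(_ _ (row_table_in r))/eqP.
Qed.

Lemma val_table_array r j :
  table_array t r j = nth 0 (nth [::] t r) j :> nat.
Proof.
case/and5P: compl_t => _ _ _ /allP/(_ _ (row_table_in r))/allP lek _.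
by rewrite /table_array inordK // lek // mem_nth // size_row_table.
Qed.

Lemma mem_row_table (r : 'I_6) a :
  a \in nth [::] t r -> exists j, table_array t r j = a :> nat.
Proof.
case/(nthP 0) => j; rewrite size_row_table => js <-.
by exists (Ordinal js); rewrite val_table_array.
Qed.

Lemma complete_table_array : complete_array (table_array t).
Proof.
case/and5P: (compl_t) => _ _ /allP uniq_t _ /allrelP compl.
have nth_col j (r : 'I_6) :
    nth 0 [seq nth 0 l j | l <- t] r = nth 0 (nth [::] t r) j.
  by rewrite (nth_map [::]) // size_table.
split.
- move=> r i j /(congr1 val) /=; rewrite !val_table_array => /eqP.
  rewrite nth_uniq ?size_row_table //; first by move/eqP/val_inj.
  by apply: uniq_t; rewrite mem_cat row_table_in.
- move=> j r r' /(congr1 val) /=; rewrite !val_table_array -!nth_col => /eqP.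
  rewrite nth_uniq ?size_map ?size_table //; first by move/eqP/val_inj.
  apply: uniq_t; rewrite mem_cat; apply/orP; right; apply: map_f.
  by rewrite mem_iota /=.
move=> a b; have /(_ a b) := compl; rewrite !mem_iota !ltn_ord => /(_ isT isT).
case/hasP => l; rewrite mem_cat => /orP[/(nthP [::])[r] | /mapP[j]].
  rewrite size_table => r6 <- /andP[].
  case/(@mem_row_table (Ordinal r6)) => i ia.
  case/(@mem_row_table (Ordinal r6)) => j jb.
  by left; exists (Ordinal r6), i, j; split; apply: val_inj.
rewrite mem_iota /= => js -> /andP[].
case/(nthP 0) => r; rewrite size_map size_table => r6.
rewrite (nth_col j (Ordinal r6)) => ra.
case/(nthP 0) => r'; rewrite size_map size_table => r6'.
rewrite (nth_col j (Ordinal r6')) => rb.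
right; exists (Ordinal js), (Ordinal r6), (Ordinal r6').
by split; apply: val_inj; rewrite /= val_table_array.
Qed.

Lemma complete_table_coloring : has_complete_coloring (rook 6 s) k.+1.
Proof.
by have := complete_array_coloring complete_table_array; rewrite !card_ord.
Qed.

End Tables.

(** * Extending a core by columns filled from four row triples *)

Section Extension.

(* Row [r] carries the colours of type [half_type r false] in the first half of
   the added columns and those of type [half_type r true] in the second half;
   the types 0, 1, 2, 3 live on the row triples 024, 035, 125, 134. *)
Definition half_table : seq (nat * nat) :=
  [:: (0, 1); (3, 2); (2, 0); (1, 3); (0, 3); (2, 1)].

Definition half_type (r : nat) (h : bool) : nat :=
  let p := nth (0, 0) half_table r in if h then p.2 else p.1.

(** Core and added colours share no column, so each core colour has to meet every triple in a
    row. *)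
Definition meets_types (k : nat) (t : seq (seq nat)) : bool :=
  allrel (fun a d => has (fun r => (a \in nth [::] t r) &&
    ((half_type r false == d) || (half_type r true == d))) (iota 0 6))
    (iota 0 k) (iota 0 4).

Lemma half_type_lt4 r h : half_type r h < 4.
Proof. by case: h; do 7!(case: r => [|r] //). Qed.

Lemma half_type_neq (r : 'I_6) : half_type r false != half_type r true.
Proof. by case: r => r; do 6!(case: r => [|r] //). Qed.

(* In the last two rows each half is rotated by one column, because each type
   has two rows where it occupies the same half. *)
Definition rotate_half (r m : nat) (i : 'I_m) : 'I_m :=
  if r < 4 then i else ordS i.

Lemma rotate_half_inj r m : injective (@rotate_half r m).
Proof.
by rewrite /rotate_half => i j; case: (r < 4) => // /(bij_inj (@ordS_bij m)).
Qed.

Lemma rotate_half_surj r m (i : 'I_m) : exists j, rotate_half r j = i.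
Proof.
rewrite /rotate_half; case: (r < 4); first by exists i.
by exists (ord_pred i); rewrite ord_predK.
Qed.

Lemma ordS_neq m (i : 'I_m) : m != 1 -> ordS i != i.
Proof.
move=> m1; rewrite -val_eqE /=; have := ltn_ord i.
rewrite leq_eqVlt => /orP[/eqP im|lt]; last by rewrite modn_small //; lia.
by rewrite im modnn; lia.
Qed.

Variables (s k m : nat) (t : seq (seq nat)).
Hypotheses (m_neq1 : m != 1).
Hypotheses (compl_t : complete_table s k t) (types_t : meets_types k.+1 t).

Definition extended_array (r : 'I_6) (j : 'I_s + bool * 'I_m) :
    'I_k.+1 + 'I_4 * 'I_m :=
  match j with
  | inl j => inl (table_array k t r j)
  | inr (h, i) => inr (Ordinal (half_type_lt4 r h), rotate_half r i)
  end.

Lemma extended_row_surj (r : 'I_6) (d : 'I_4) (i : 'I_m) :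
    (half_type r false == d) || (half_type r true == d) ->
  exists j, extended_array r j = inr (d, i).
Proof.
have [j rj] := rotate_half_surj r i.
by case/orP => /eqP rd; [exists (inr (false, j)) | exists (inr (true, j))];
  rewrite /= rj; congr (inr (_, _)); apply: val_inj.
Qed.

(** When two rows carry the same type in the same half, exactly one of them is among the rotated
    last two; for [m != 1] the rotation has no fixed point. *)
Lemma half_type_rotate_inj h i (r r' : 'I_6) :
    half_type r h = half_type r' h ->
  rotate_half r i = rotate_half r' i :> 'I_m -> r = r'.
Proof.
move=> hrr rot; have lt4 : (r < 4) = (r' < 4).
  have := ordS_neq i m_neq1; move: rot; rewrite /rotate_half.
  by case: (r < 4); case: (r' < 4) => // /eqP e; rewrite ?e // eq_sym e.
have : all2rel (fun r r' => (half_type r h == half_type r' h) &&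
    ((r < 4) == (r' < 4)) ==> (r == r')) (iota 0 6) by case: h {hrr}.
move/allrelP/(_ r r'); rewrite !mem_iota !ltn_ord hrr lt4 !eqxx.
by move/(_ isT isT)/eqP/val_inj.
Qed.

(** A row carries all [m] colours of each of its types, so this makes any two added colours meet. *)
Lemma types_share_row (d d' : 'I_4) : exists r : 'I_6,
  ((half_type r false == d) || (half_type r true == d)) &&
  ((half_type r false == d') || (half_type r true == d')).
Proof.
have : allrel (fun d d' => has (fun r =>
    ((half_type r false == d) || (half_type r true == d)) &&
    ((half_type r false == d') || (half_type r true == d'))) (iota 0 6))
  (iota 0 4) (iota 0 4) by [].
move/allrelP/(_ d d'); rewrite !mem_iota !ltn_ord => /(_ isT isT)/hasP[r].
by rewrite mem_iota => r6; exists (Ordinal r6).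
Qed.

Lemma complete_extended_array : complete_array extended_array.
Proof.
have [row_inj col_inj compl] := complete_table_array compl_t.
split.
- move=> r [i|[h i]] [j|[h' j]] //= [].
    by move/row_inj ->.
  move=> hh ij; rewrite (rotate_half_inj ij); congr (inr (_, _)).
  by have /eqP neq := half_type_neq r; case: h h' hh => -[] // e; case: neq.
- move=> [j|[h i]] r r' /= []; first by move/col_inj.
  exact: half_type_rotate_inj.
have mixed (a : 'I_k.+1) (d : 'I_4) (i : 'I_m) : exists r j j',
    extended_array r j = inl a /\ extended_array r j' = inr (d, i).
  move/allrelP: types_t => /(_ a d); rewrite !mem_iota !ltn_ord.
  case/(_ isT isT)/hasP => r; rewrite mem_iota => r6 /andP[ar dr].
  have [j ja] := @mem_row_table _ _ _ compl_t (Ordinal r6) _ ar.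
  have [j' jd] := @extended_row_surj (Ordinal r6) d i dr.
  by exists (Ordinal r6), (inl j), j'; split=> //=; congr inl; apply: val_inj.
move=> [a|[d i]] [b|[d' i']].
- have [[r [i [j [<- <-]]]]|[j [r [r' [<- <-]]]]] := compl a b.
    by left; exists r, (inl i), (inl j).
  by right; exists (inl j), r, r'.
- by left; apply: mixed.
- by have [r [j [j' [ja jd]]]] := mixed b d i; left; exists r, j', j.
have [r /andP[dr dr']] := types_share_row d d'.
have [j jd] := extended_row_surj i dr.
have [j' jd'] := extended_row_surj i' dr'.
by left; exists r, j, j'.
Qed.

Lemma complete_extended_coloring :
  has_complete_coloring (rook 6 (s + 2 * m)) (k.+1 + 4 * m).
Proof.
have := complete_array_coloring complete_extended_array.
by rewrite !card_sum !card_prod card_bool !card_ord.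
Qed.

End Extension.

(** * Explicit cores and small cases *)

(** Each colour fills both rows of one row pair, hence meets every triple, and misses only one of
    the three columns, so any two colours share a column. *)
Definition core3 : seq (seq nat) :=
  [:: [:: 0; 1; 2]; [:: 1; 2; 0]; [:: 3; 4; 5];
      [:: 4; 5; 3]; [:: 6; 7; 8]; [:: 7; 8; 6]].

(* The tables for 4, 5 and 6 columns were found by simulated annealing. *)
Definition core4 : seq (seq nat) :=
  [:: [:: 8; 0; 4; 7]; [:: 7; 4; 0; 8]; [:: 10; 3; 9; 5];
      [:: 3; 10; 5; 9]; [:: 6; 2; 1; 0]; [:: 1; 5; 6; 2]].

Definition table1 : seq (seq nat) :=
  [:: [:: 0]; [:: 1]; [:: 2]; [:: 3]; [:: 4]; [:: 5]].

(** Colours 1 to 5 lie in both columns; 0 and 6 occur once each and meet in the first row. *)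
Definition table2 : seq (seq nat) :=
  [:: [:: 0; 6]; [:: 1; 2]; [:: 2; 3]; [:: 3; 4]; [:: 4; 5]; [:: 5; 1]].

Definition table5 : seq (seq nat) :=
  [:: [:: 10; 12; 6; 7; 0]; [:: 4; 5; 7; 9; 3]; [:: 5; 3; 11; 8; 2];
      [:: 9; 4; 2; 12; 11]; [:: 8; 1; 4; 6; 10]; [:: 0; 6; 1; 11; 9]].

Definition table6 : seq (seq nat) :=
  [:: [:: 5; 0; 14; 7; 11; 1]; [:: 14; 5; 0; 10; 6; 12]; [:: 3; 14; 4; 2; 5; 6];
      [:: 0; 8; 13; 1; 4; 3]; [:: 8; 4; 12; 11; 7; 9]; [:: 9; 10; 2; 3; 13; 8]].

Lemma exists_complete_coloring_K6 q : 0 < q ->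
  exists2 k, 2 * q + 3 <= k & has_complete_coloring (rook 6 q) k.
Proof.
move=> q_gt0.
(* The values 1 and 2 are smaller than the cores; 5 and 6 would need [m = 1], where rotation is the
   identity. *)
have [-> | q1] := eqVneq q 1.
  by exists 6 => //; apply: (@complete_table_coloring 1 5 table1); vm_compute.
have [-> | q2] := eqVneq q 2.
  by exists 7 => //; apply: (@complete_table_coloring 2 6 table2); vm_compute.
have [-> | q5] := eqVneq q 5.
  by exists 13 => //; apply: (@complete_table_coloring 5 12 table5); vm_compute.
have [-> | q6] := eqVneq q 6.
  by exists 15 => //; apply: (@complete_table_coloring 6 14 table6); vm_compute.
(* Both cores have [2 * s + 3] colours on [s] columns, and adding [2 * m] columns with [4 * m]
   colours keeps the excess 3. *)
have [odd_q | even_q] := boolP (odd q).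
  pose m := (q - 3)./2; have -> : q = 3 + 2 * m by rewrite /m; lia.
  exists (9 + 4 * m); first by lia.
  by apply: (@complete_extended_coloring 3 8 m core3);
    [rewrite /m; lia | vm_compute..].
pose m := (q - 4)./2; have -> : q = 4 + 2 * m by rewrite /m; lia.
exists (11 + 4 * m); first by lia.
by apply: (@complete_extended_coloring 4 10 m core4);
    [rewrite /m; lia | vm_compute..].
Qed.

Theorem corollary17 (q : nat) (hq : 0 < q) :
  2 * q + 3 <= achr (cartesian_product (complete_graph 6) (complete_graph q))
            <= 2 * q + 6.
Proof.
apply/andP; split; last first.
  by apply/bigmax_leqP => k; apply: complete_coloring_K6_leq.
have [k le_k ck] := exists_complete_coloring_K6 hq.
exact: leq_trans le_k (leq_achr ck).
Qed.
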